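(* For any $m,k\in\mathbb{N}$, the fragments $\Sigma_{0,m,k}^{\mathfrak{B}}$ and $\Sigma_{0,m,k}^{\mathfrak{D}}$ are decidable.
   Context: $\mathcal{L}_{BT}$ is the first-order language (with equality) consisting of the constant symbols $e,0,1$, the binary function symbol $\circ$ and the binary relation symbol $\sqsubseteq$ (also written $\preceq$ when working with $\mathfrak{D}$). The $\mathcal{L}_{BT}$-structures $\mathfrak{B}$ and $\mathfrak{D}$ both have universe $\{\boldsymbol{0},\boldsymbol{1}\}^*$, the set of all finite bit strings including the empty string $\varepsilon$; in both, $e$ is interpreted as $\varepsilon$, $0$ as the one-bit string $\boldsymbol{0}$, $1$ as the one-bit string $\boldsymbol{1}$, and $\circ$ as concatenation. In $\mathfrak{B}$, $u\sqsubseteq v$ holds iff $u$ is a substring of $v$ (there exist bit strings $x,y$ with $xuy=v$). In $\mathfrak{D}$, $u\sqsubseteq v$ holds iff $u$ is a prefix of $v$ (there exists a bit string $x$ with $ux=v$). Bounded quantifiers: $(\exists x\sqsubseteq t)\alpha$ abbreviates $(\exists x)[x\sqsubseteq t\wedge\alpha]$ and $(\forall x\sqsubseteq t)\alpha$ abbreviates $(\forall x)[x\sqsubseteq t\rightarrow\alpha]$, where $x$ does not occur in the term $t$. The $\Sigma$-formulas are defined inductively: $\alpha$ and $\neg\alpha$ are $\Sigma$-formulas if $\alpha$ is of the form $s\sqsubseteq t$ or $s=t$ for terms $s,t$; $\alpha\vee\beta$ and $\alpha\wedge\beta$ are $\Sigma$-formulas if $\alpha,\beta$ are; $(\exists x\sqsubseteq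 t)\alpha$, $(\forall x\sqsubseteq t)\alpha$ and $(\exists x)\alpha$ are $\Sigma$-formulas if $\alpha$ is. A $\Sigma$-formula is a $\Sigma_{n,m,k}$-formula if it contains $n$ unbounded existential quantifiers, $m$ bounded existential quantifiers and $k$ bounded universal quantifiers. A sentence is a formula with no free variables. For $\mathfrak{A}\in\{\mathfrak{B},\mathfrak{D}\}$, the fragment $\Sigma_{n,m,k}^{\mathfrak{A}}$ is the set of $\Sigma_{n,m,k}$-sentences true in $\mathfrak{A}$. A fragment is decidable if there is an algorithm deciding membership in this set. *)

(* Defs.v *)
From mathcomp Require Import all_boot.
From Stdlib Require Cantor.

Set Implicit Arguments.
Unset Strict Implicit.
Unset Printing Implicit Defensive.

(* Variables are natural numbers (named variables, not de Bruijn indices). *)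
Inductive term : Type :=
  | Var of nat
  | E
  | Zero
  | One
  | Cat of term & term.

Inductive formula : Type :=
  | Eq of term & term
  | Sub of term & term
  | Not of formula
  | And of formula & formula
  | Or of formula & formula
  | Imp of formula & formula
  | Ex of nat & formula
  | All of nat & formula.

Fixpoint occurs (x : nat) (t : term) : bool :=
  match t with
  | Var y => x == y
  | Cat s u => occurs x s || occurs x u
  | _ => false
  end.

Fixpoint free (x : nat) (f : formula) : bool :=
  match f with
  | Eq s t | Sub s t => occurs x s || occurs x t
  | Not a => free x a
  | And a b | Or a b | Imp a b => free x a || free x b
  | Ex y a | All y a => (x != y) && free x a
  end.

Definition sentence (f : formula) : Prop := forall x, ~~ free x f.

Record structure : Type := Structure {
  dom :> Type;
  int_e : dom;
  int_0 : dom;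
  int_1 : dom;
  int_cat : dom -> dom -> dom;
  int_sub : dom -> dom -> Prop
}.

Fixpoint teval (A : structure) (v : nat -> A) (t : term) : A :=
  match t with
  | Var x => v x
  | E => int_e A
  | Zero => int_0 A
  | One => int_1 A
  | Cat s u => int_cat (teval v s) (teval v u)
  end.

Definition update (T : Type) (v : nat -> T) (x : nat) (a : T) : nat -> T :=
  fun y => if y == x then a else v y.

Fixpoint sat (A : structure) (v : nat -> A) (f : formula) : Prop :=
  match f with
  | Eq s t => teval v s = teval v t
  | Sub s t => int_sub (teval v s) (teval v t)
  | Not a => ~ sat v a
  | And a b => sat v a /\ sat v b
  | Or a b => sat v a \/ sat v b
  | Imp a b => sat v a -> sat v b
  | Ex x a => exists u : A, sat (update v x u) a
  | All x a => forall u : A, sat (update v x u) a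
  end.

Definition true_in (A : structure) (f : formula) : Prop :=
  forall v : nat -> A, sat v f.

Definition bitstring : Type := seq bool.

Definition substring (u v : bitstring) : Prop :=
  exists x y : bitstring, x ++ u ++ y = v.

Definition is_prefix (u v : bitstring) : Prop :=
  exists x : bitstring, u ++ x = v.

Definition strB : structure :=
  @Structure bitstring [::] [:: false] [:: true] cat substring.

Definition strD : structure :=
  @Structure bitstring [::] [:: false] [:: true] cat is_prefix.

Definition BEx (x : nat) (t : term) (a : formula) : formula :=
  Ex x (And (Sub (Var x) t) a).

Definition BAll (x : nat) (t : term) (a : formula) : formula :=
  All x (Imp (Sub (Var x) t) a).

(* [Sigma n m k f]: f is a Sigma-formula with n unbounded existential,
   m bounded existential and k bounded universal quantifiers.  Since [BEx] is
   an abbreviation, a bounded existential can also be read as an unbounded one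
   over a conjunction; for n = 0 the counts m and k are determined by f. *)
Inductive Sigma : nat -> nat -> nat -> formula -> Prop :=
  | Sigma_Eq s t : Sigma 0 0 0 (Eq s t)
  | Sigma_Sub s t : Sigma 0 0 0 (Sub s t)
  | Sigma_NotEq s t : Sigma 0 0 0 (Not (Eq s t))
  | Sigma_NotSub s t : Sigma 0 0 0 (Not (Sub s t))
  | Sigma_Or n m k n' m' k' a b : Sigma n m k a -> Sigma n' m' k' b ->
      Sigma (n + n') (m + m') (k + k') (Or a b)
  | Sigma_And n m k n' m' k' a b : Sigma n m k a -> Sigma n' m' k' b ->
      Sigma (n + n') (m + m') (k + k') (And a b)
  | Sigma_BEx n m k x t a : ~~ occurs x t -> Sigma n m k a ->
      Sigma n m.+1 k (BEx x t a)
  | Sigma_BAll n m k x t a : ~~ occurs x t -> Sigma n m k a ->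
      Sigma n m k.+1 (BAll x t a)
  | Sigma_Ex n m k x a : Sigma n m k a -> Sigma n.+1 m k (Ex x a).

Definition fragment (n m k : nat) (A : structure) (f : formula) : Prop :=
  [/\ Sigma n m k f, sentence f & true_in A f].

(* Partial recursive functions act on argument lists; arities are not
   tracked, and [RSucc] and [RProj] read a missing argument as 0. *)
Inductive recfun : Type :=
  | RZero
  | RSucc
  | RProj of nat
  | RComp of recfun & seq recfun
  | RPrec of recfun & recfun
  | RMin of recfun.

(* [computes f v y]: f is defined on the arguments v, with value y. *)
Inductive computes : recfun -> seq nat -> nat -> Prop :=
  | C_Zero v : computes RZero v 0
  | C_Succ v : computes RSucc v (nth 0 v 0).+1
  | C_Proj i v : computes (RProj i) v (nth 0 v i)
  | C_Comp f gs v w y : size w = size gs ->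
      (forall i, i < size gs -> computes (nth RZero gs i) v (nth 0 w i)) ->
      computes f w y -> computes (RComp f gs) v y
  | C_Prec0 f g v y : computes f v y -> computes (RPrec f g) (0 :: v) y
  | C_PrecS f g n v z y : computes (RPrec f g) (n :: v) z ->
      computes g [:: n, z & v] y -> computes (RPrec f g) (n.+1 :: v) y
  | C_Min f v n (h : nat -> nat) :
      (forall i, i < n -> computes f (i :: v) (h i).+1) ->
      computes f (n :: v) 0 -> computes (RMin f) v n.

(* An inhabitant of [S n \/ ~ S n], or a [bool]-valued function obtained by
   choice, would carry no algorithm; hence the explicit model of computation. *)
Definition decidable_nat (S : nat -> Prop) : Prop :=
  exists f : recfun, forall n,
    (S n -> computes f [:: n] 1) /\ (~ S n -> computes f [:: n] 0).

Definition pair_code (x y : nat) : nat := Cantor.to_nat (x, y).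

Fixpoint term_code (t : term) : nat :=
  match t with
  | Var x => pair_code 0 x
  | E => pair_code 1 0
  | Zero => pair_code 2 0
  | One => pair_code 3 0
  | Cat s u => pair_code 4 (pair_code (term_code s) (term_code u))
  end.

Fixpoint formula_code (f : formula) : nat :=
  match f with
  | Eq s t => pair_code 0 (pair_code (term_code s) (term_code t))
  | Sub s t => pair_code 1 (pair_code (term_code s) (term_code t))
  | Not a => pair_code 2 (formula_code a)
  | And a b => pair_code 3 (pair_code (formula_code a) (formula_code b))
  | Or a b => pair_code 4 (pair_code (formula_code a) (formula_code b))
  | Imp a b => pair_code 5 (pair_code (formula_code a) (formula_code b))
  | Ex x a => pair_code 6 (pair_code x (formula_code a))
  | All x a => pair_code 7 (pair_code x (formula_code a))
  end.

Definition decidable_set (S : formula -> Prop) : Prop :=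
  decidable_nat (fun n => exists2 f, S f & formula_code f = n).

Lemma computes_functional f v y z :
  computes f v y -> computes f v z -> y = z.
Proof.
move=> H; elim: H z => {f v y}.
- by move=> v z H; inversion H.
- by move=> v z H; inversion H.
- by move=> i v z H; inversion H.
- move=> f gs v w y sw _ IHg _ IHf z H.
  inversion H as [| | |? ? ? w' ? sw' Hg Hf| | |]; subst.
  suff Ew : w = w' by apply: IHf; rewrite Ew.
  apply: (@eq_from_nth _ 0); first by rewrite sw.
  by move=> i; rewrite sw => lti; apply: IHg => //; apply: Hg.
- by move=> f g v y _ IH z H; inversion H; subst; apply: IH.
- move=> f g n v x y _ IHx _ IHy z H.
  inversion H as [| | | | |? ? ? ? x' ? Hx Hy|]; subst.
  by apply: IHy; rewrite (IHx _ Hx).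
- move=> f v n h _ IHlt _ IHn z H.
  inversion H as [| | | | | |? ? ? h' Hlt Hz]; subst.
  case: (ltngtP n z) => // ltz.
  + by have := IHn _ (Hlt _ ltz).
  + by have := IHlt _ ltz _ Hz.
Qed.

Lemma pair_code_inj x y x' y' :
  pair_code x y = pair_code x' y' -> x = x' /\ y = y'.
Proof. by move=> /Cantor.to_nat_inj[-> ->]. Qed.

Lemma term_code_inj : injective term_code.
Proof.
elim=> [x||||s IHs t IHt] [x'||||s' t'] //= /pair_code_inj[] // _.
- by move=> ->.
- by move=> /pair_code_inj[/IHs -> /IHt ->].
Qed.

Lemma formula_code_inj : injective formula_code.
Proof.
elim=> [s t|s t|a IHa|a IHa b IHb|a IHa b IHb|a IHa b IHb|x a IHa|x a IHa];
  case=> [s' t'|s' t'|a'|a' b'|a' b'|a' b'|x' a'|x' a'] //=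
  /pair_code_inj[] // _.
- by move=> /pair_code_inj[/term_code_inj -> /term_code_inj ->].
- by move=> /pair_code_inj[/term_code_inj -> /term_code_inj ->].
- by move=> /IHa ->.
- by move=> /pair_code_inj[/IHa -> /IHb ->].
- by move=> /pair_code_inj[/IHa -> /IHb ->].
- by move=> /pair_code_inj[/IHa -> /IHb ->].
- by move=> /pair_code_inj[-> /IHa ->].
- by move=> /pair_code_inj[-> /IHa ->].
Qed.

(* Main.v *)
From mathcomp Require Import all_boot zify.
From Stdlib Require Cantor.
Require Import Defs.

Set Implicit Arguments.
Unset Strict Implicit.
Unset Printing Implicit Defensive.

(** A bounded quantifier ranges over the prefixes, or substrings, of one string,
    so it runs over a finite set, and the truth of a formula without unbounded
    quantifiers can be found by exhaustive search.  What takes work is to carry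
    out this evaluation, and the recognition of the admissible sentences, inside
    the partial recursive functions.

    The work is done with total functions [nat -> nat] that some [recfun]
    computes ([computable]); several arguments are packed into one by the Cantor
    pairing.  This class is closed under composition, pairing, case distinction,
    primitive recursion ([computable_iteri]), bounded search ([computable_has])
    and course-of-values recursion ([computable_cov]).  The code of a compound
    term or formula exceeds the codes of its immediate subterms or subformulas, so
    a syntactic notion defined by structural recursion becomes a course-of-values
    recursion on codes.  That covers being a term, occurrence, freeness,
    evaluation of terms, and the shape and quantifier counts of a Sigma formula
    ([sigma_code_sound], [sigma_code_complete]).

    Truth is harder, because a quantifier changes the environment, which a
    course-of-values recursion has to keep fixed.  But the numbers [m] and [k] of
    the fragment are given in advance, so the evaluator [sat_code] can be
    built by an outer recursion on the number [q] of quantifiers it can handle: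
    level [q + 1] calls level [q] on the matrix of a quantifier, and every level
    is one more instance of the closure properties ([sat_codeP],
    [computable_sat]).

    A string is coded as a list of nested pairs, which makes a prefix or substring
    of [v] have a code at most that of [v]; this bounds the search.  Finally, a
    sentence has the same truth value under every valuation ([sat_eq]), so it is
    evaluated in the empty environment ([decidable_fragment]).  Both structures
    are instances: they differ only in the relation, and both relations are
    decided by bounded search on codes. *)

(** * Cantor pairing *)

Arguments pair_code : simpl never.

Definition fst_code (n : nat) : nat := (Cantor.of_nat n).1.
Definition snd_code (n : nat) : nat := (Cantor.of_nat n).2.

#[local] Arguments fst_code : simpl never.
#[local] Arguments snd_code : simpl never.

(** The Cantor pairing numbers the points of the plane along the antidiagonals
    [x + y = d], the first of which has number [triangle d]. *)
Definition triangle (n : nat) : nat := iteri n (fun i s => i.+1 + s) 0.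

Lemma pair_codeE x y : pair_code x y = y + triangle (x + y).
Proof.
by rewrite /pair_code /= plusE [x + y]addnC; congr addn.
Qed.

Lemma fst_pair x y : fst_code (pair_code x y) = x.
Proof. by rewrite /fst_code Cantor.cancel_of_to. Qed.

Lemma snd_pair x y : snd_code (pair_code x y) = y.
Proof. by rewrite /snd_code Cantor.cancel_of_to. Qed.

Lemma pair_fst_snd n : pair_code (fst_code n) (snd_code n) = n.
Proof. by rewrite /pair_code -surjective_pairing Cantor.cancel_to_of. Qed.

Lemma leq_triangle m n : m <= n -> triangle m <= triangle n.
Proof.
elim: n => [|n IH]; first by rewrite leqn0 => /eqP ->.
by rewrite leq_eqVlt => /predU1P[-> //|/IH /=]; lia.
Qed.

Lemma triangle_ge n : n <= triangle n.
Proof. by case: n => //= n; apply: leq_addr. Qed.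

Lemma leq_pair x x' y y' :
  x <= x' -> y <= y' -> pair_code x y <= pair_code x' y'.
Proof.
by move=> lex ley; rewrite !pair_codeE leq_add // leq_triangle // leq_add.
Qed.

Lemma leq_pairl x y : x <= pair_code x y.
Proof. by rewrite pair_codeE; have := triangle_ge (x + y); lia. Qed.

Lemma leq_pairr x y : y <= pair_code x y.
Proof. by rewrite pair_codeE leq_addr. Qed.

Lemma ltn_pairr x y : 0 < x -> y < pair_code x y.
Proof. by rewrite pair_codeE; have := triangle_ge (x + y); lia. Qed.

Lemma leq_fst n : fst_code n <= n.
Proof. by rewrite -{2}(pair_fst_snd n) leq_pairl. Qed.

Lemma leq_snd n : snd_code n <= n.
Proof. by rewrite -{2}(pair_fst_snd n) leq_pairr. Qed.

Lemma ltn_snd n : 0 < fst_code n -> snd_code n < n.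
Proof. by move=> /(@ltn_pairr _ (snd_code n)); rewrite pair_fst_snd. Qed.

Definition diagonal (n : nat) : nat := fst_code n + snd_code n.

Lemma diagonal_bounds n :
  triangle (diagonal n) <= n < triangle (diagonal n).+1.
Proof.
by rewrite -{2 3}(pair_fst_snd n) pair_codeE /diagonal /=; lia.
Qed.

Lemma snd_diagonal n : snd_code n = n - triangle (diagonal n).
Proof. by rewrite -{2}(pair_fst_snd n) pair_codeE -/(diagonal n) addnK. Qed.

Lemma fst_diagonal n : fst_code n = diagonal n - snd_code n.
Proof. by rewrite addnK. Qed.

(** * Total computable functions *)

Lemma computes_comp1 f g v a y :
  computes g v a -> computes f [:: a] y -> computes (RComp f [:: g]) v y.
Proof. by move=> ga; apply: (C_Comp (w := [:: a])) => // -[]. Qed.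

Lemma computes_comp2 f g h v a b y :
  computes g v a -> computes h v b -> computes f [:: a; b] y ->
  computes (RComp f [:: g; h]) v y.
Proof. by move=> ga hb; apply: (C_Comp (w := [:: a; b])) => // -[|[]]. Qed.

Definition computable (F : nat -> nat) : Prop :=
  exists f, forall n, computes f [:: n] (F n).

Definition computable2 (H : nat -> nat -> nat) : Prop :=
  exists f, forall a b, computes f [:: a; b] (H a b).

Lemma computable_ext F G : F =1 G -> computable F -> computable G.
Proof. by move=> eqFG [f Hf]; exists f => n; rewrite -eqFG. Qed.

Lemma computable_comp1 H F :
  computable H -> computable F -> computable (fun x => H (F x)).
Proof.
by move=> [h Hh] [f Hf]; exists (RComp h [:: f]) => n; apply: computes_comp1.
Qed.

Lemma computable_comp2 H F G : computable2 H ->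
  computable F -> computable G -> computable (fun x => H (F x) (G x)).
Proof.
move=> [h Hh] [f Hf] [g Hg]; exists (RComp h [:: f; g]) => n.
exact: computes_comp2.
Qed.

Lemma computable2_comp1 H G :
  computable H -> computable2 G -> computable2 (fun x y => H (G x y)).
Proof.
by move=> [h Hh] [g Hg]; exists (RComp h [:: g]) => a b; apply: computes_comp1.
Qed.

Lemma computable2_comp2 H F G : computable2 H ->
  computable2 F -> computable2 G -> computable2 (fun x y => H (F x y) (G x y)).
Proof.
move=> [h Hh] [f Hf] [g Hg]; exists (RComp h [:: f; g]) => a b.
exact: computes_comp2.
Qed.

Lemma computable_id : computable (fun x => x).
Proof. by exists (RProj 0) => n; apply: (C_Proj 0). Qed.

Lemma computable2_fst : computable2 (fun x y => x).
Proof. by exists (RProj 0) => a b; apply: (C_Proj 0 [:: a; b]). Qed.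

Lemma computable2_snd : computable2 (fun x y => y).
Proof. by exists (RProj 1) => a b; apply: (C_Proj 1 [:: a; b]). Qed.

Lemma computable_succ : computable succn.
Proof. by exists RSucc => n; apply: (C_Succ [:: n]). Qed.

Lemma computable_const c : computable (fun=> c).
Proof.
elim: c => [|c IH]; first by exists RZero => n; apply: C_Zero.
exact: (computable_comp1 computable_succ IH).
Qed.

Lemma computable_pred : computable predn.
Proof.
exists (RPrec RZero (RProj 0)); elim=> [|n IH].
  by apply: C_Prec0; apply: C_Zero.
by apply: (C_PrecS IH); apply: (C_Proj 0 [:: n; n.-1]).
Qed.

Lemma computable2_add : computable2 addn.
Proof.
have [s Hs] := computable_succ.
exists (RPrec (RProj 0) (RComp s [:: RProj 1])) => a b.
elim: a => [|a IH]; first by apply: C_Prec0; apply: (C_Proj 0 [:: b]).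
by apply: (C_PrecS IH); apply: computes_comp1 (C_Proj _ _) (Hs _).
Qed.

(** Primitive recursion runs on the first argument, hence the order. *)
Lemma computable2_subr : computable2 (fun a b => b - a).
Proof.
have [p Hp] := computable_pred.
exists (RPrec (RProj 0) (RComp p [:: RProj 1])) => a b.
elim: a => [|a IH].
  by rewrite subn0; apply: C_Prec0; apply: (C_Proj 0 [:: b]).
by rewrite subnS; apply: (C_PrecS IH); apply: computes_comp1 (C_Proj _ _) (Hp _).
Qed.

Lemma computable2_sub : computable2 subn.
Proof.
exact: computable2_comp2 computable2_subr computable2_snd computable2_fst.
Qed.

Lemma computable_triangle : computable triangle.
Proof.
have [g Hg] := computable2_comp2 computable2_add
  (computable2_comp1 computable_succ computable2_fst) computable2_snd.
exists (RPrec RZero g); elim=> [|n IH].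
  by apply: C_Prec0; apply: C_Zero.
by apply: (C_PrecS IH); apply: Hg.
Qed.

Lemma computable2_pair : computable2 pair_code.
Proof.
have [f Hf] := computable2_comp2 computable2_add computable2_snd
  (computable2_comp1 computable_triangle computable2_add).
by exists f => a b; rewrite pair_codeE.
Qed.

(** The projections need the antidiagonal of [n], which by [diagonal_bounds] is
    the least [d] with [n < triangle d.+1]: an unbounded minimisation that always
    succeeds. *)
Lemma computable_diagonal : computable diagonal.
Proof.
have [f Hf] := computable2_comp2 computable2_sub
  (computable2_comp1 computable_succ computable2_snd)
  (computable2_comp1 computable_triangle
     (computable2_comp1 computable_succ computable2_fst)).
exists (RMin f) => n; have /andP[lo hi] := diagonal_bounds n.
apply: (C_Min (h := fun i => (n.+1 - triangle i.+1).-1)) => [i lti|].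
  (* Before the minimum the tested value is positive, as minimisation demands. *)
  rewrite /= prednK; first exact: Hf.
  by rewrite subn_gt0 ltnS (leq_trans (leq_triangle lti)).
have <- : n.+1 - triangle (diagonal n).+1 = 0 by lia.
exact: Hf.
Qed.

Lemma computable_snd_code : computable snd_code.
Proof.
apply: (computable_ext (fun n => esym (snd_diagonal n))).
exact: computable_comp2 computable2_sub computable_id
  (computable_comp1 computable_triangle computable_diagonal).
Qed.

Lemma computable_fst_code : computable fst_code.
Proof.
apply: (computable_ext (fun n => esym (fst_diagonal n))).
exact: computable_comp2 computable2_sub computable_diagonal computable_snd_code.
Qed.

(** Lets the computability of a two-place function be checked on the projections
    alone, where it is found by proof search, and then used at any arguments. *)
Lemma computable_uncurried (H : nat -> nat -> nat) F G :
  computable (fun w => H (fst_code w) (snd_code w)) ->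
  computable F -> computable G -> computable (fun x => H (F x) (G x)).
Proof.
move=> compH compF compG.
apply: computable_ext
  (computable_comp1 compH (computable_comp2 computable2_pair compF compG)).
by move=> x; rewrite fst_pair snd_pair.
Qed.

(** Primitive recursion with the variable [x] of the context as parameter.  The
    step sees the loop counter, the previous value and [x], packed into a single
    number, so that nested loops and searches stay within unary functions. *)
Lemma computable_iteri (A N : nat -> nat) (S : nat -> nat -> nat -> nat) :
  computable A ->
  computable (fun w => S (fst_code w) (fst_code (snd_code w))
                         (snd_code (snd_code w))) ->
  computable N ->
  computable (fun x => iteri (N x) (fun i z => S i z x) (A x)).
Proof.
move=> [a Ha] [s Hs]; have [p Hp] := computable2_pair.
pose g := RComp s [:: RComp p [:: RProj 0; RComp p [:: RProj 1; RProj 2]]].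
have Hg n z x : computes g [:: n; z; x] (S n z x).
  apply: (computes_comp1 (a := pair_code n (pair_code z x))).
    apply: (computes_comp2 _ _ (Hp _ _)); first exact: (C_Proj 0 [:: n; z; x]).
    apply: (computes_comp2 _ _ (Hp _ _)); first exact: (C_Proj 1 [:: n; z; x]).
    exact: (C_Proj 2 [:: n; z; x]).
  by have := Hs (pair_code n (pair_code z x)); rewrite !(fst_pair, snd_pair).
move=> compN; apply: (computable_comp2 
  (H := fun n x => iteri n (fun i z => S i z x) (A x))) compN computable_id.
exists (RPrec a g) => n x; elim: n => [|n IH]; first exact: C_Prec0.
exact: C_PrecS IH (Hg _ _ _).
Qed.

Opaque pair_code.

(** The lemmas below give one closure rule for each operation, with arbitrary
    arguments in the context variable.  Hence the computability of a function
    defined from these operations is proved by following its syntax, which is what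
    the tactic [computability] does.  Decision procedures are boolean and enter
    through the coercion to [nat]. *)
Create HintDb computability.

Lemma computable_S F : computable F -> computable (fun x => (F x).+1).
Proof. exact: computable_comp1 computable_succ. Qed.

Lemma computable_fst F : computable F -> computable (fun x => fst_code (F x)).
Proof. exact: computable_comp1 computable_fst_code. Qed.

Lemma computable_snd F : computable F -> computable (fun x => snd_code (F x)).
Proof. exact: computable_comp1 computable_snd_code. Qed.

Lemma computable_pair F G : computable F -> computable G ->
  computable (fun x => pair_code (F x) (G x)).
Proof. exact: computable_comp2 computable2_pair. Qed.

Lemma computable_add F G : computable F -> computable G ->
  computable (fun x => F x + G x).
Proof. exact: computable_comp2 computable2_add. Qed.

Lemma computable_sub F G : computable F -> computable G ->
  computable (fun x => F x - G x).
Proof. exact: computable_comp2 computable2_sub. Qed.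

#[local] Hint Resolve computable_id computable_const computable_S computable_fst
  computable_snd computable_pair computable_add computable_sub computable_iteri
  : computability.

Ltac computability := auto 100 with computability nocore.

Lemma computable_if (b : nat -> bool) F G :
  computable (fun x => b x : nat) -> computable F -> computable G ->
  computable (fun x => if b x then F x else G x).
Proof.
move=> compb compF compG.
apply: (computable_ext (F := fun x => iteri (b x) (fun _ _ => F x) (G x))).
  by move=> x; case: (b x).
apply: (computable_iteri (S := fun _ _ x => F x)) => //.
by apply: computable_comp1 compF _; computability.
Qed.

Lemma computable_ifb (b c d : nat -> bool) :
  computable (fun x => b x : nat) -> computable (fun x => c x : nat) ->
  computable (fun x => d x : nat) ->
  computable (fun x => (if b x then c x else d x) : nat).
Proof.
move=> compb compc compd.
by apply: computable_ext (computable_if compb compc compd) => x; case: (b x).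
Qed.

Lemma computable_negb (b : nat -> bool) :
  computable (fun x => b x : nat) -> computable (fun x => ~~ b x : nat).
Proof.
move=> compb; apply: (computable_ext (F := fun x => 1 - b x)).
  by move=> x; case: (b x).
by computability.
Qed.

Lemma computable_andb (b c : nat -> bool) :
  computable (fun x => b x : nat) -> computable (fun x => c x : nat) ->
  computable (fun x => b x && c x : nat).
Proof.
move=> compb compc.
apply: (computable_ext (F := fun x => if b x then c x : nat else 0)).
  by move=> x; case: (b x).
exact: computable_if compb compc (computable_const 0).
Qed.

Lemma computable_orb (b c : nat -> bool) :
  computable (fun x => b x : nat) -> computable (fun x => c x : nat) ->
  computable (fun x => b x || c x : nat).
Proof.
move=> compb compc.
apply: (computable_ext (F := fun x => if b x then 1 else c x : nat)).
  by move=> x; case: (b x).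
exact: computable_if compb (computable_const 1) compc.
Qed.

Lemma computable_leq F G : computable F -> computable G ->
  computable (fun x => F x <= G x : nat).
Proof.
move=> compF compG; apply: (computable_ext (F := fun x => 1 - (F x - G x))).
  by move=> x; rewrite /leq; case: (F x - G x).
by computability.
Qed.

Lemma computable_eq F G : computable F -> computable G ->
  computable (fun x => F x == G x : nat).
Proof.
move=> compF compG.
apply: (computable_ext (F := fun x => (F x <= G x) && (G x <= F x) : nat)).
  by move=> x; rewrite -eqn_leq.
by apply: computable_andb; apply: computable_leq.
Qed.

Lemma computable_has (P : nat -> nat -> bool) N :
  computable (fun w => P (fst_code w) (snd_code w) : nat) ->
  computable N ->
  computable (fun x => has (fun i => P i x) (iota 0 (N x)) : nat).
Proof.
move=> compP compN.
apply: (computable_ext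
  (F := fun x => iteri (N x) (fun i z => if P i x then 1 else z) 0)).
  move=> x; elim: (N x) => [//|n IH].
  by rewrite [LHS]/= IH -[n.+1]addn1 iotaD has_cat /= orbF orbC; case: (P n x).
apply: (computable_iteri (S := fun i z x => if P i x then 1 else z)) => //.
  by computability.
apply: computable_if; try by computability.
have := computable_comp1
  (F := fun w => pair_code (fst_code w) (snd_code (snd_code w))) compP.
move=> /(_ ltac:(computability)); apply: computable_ext => w /=.
by rewrite fst_pair snd_pair.
Qed.

Lemma computable_all (P : nat -> nat -> bool) N :
  computable (fun w => P (fst_code w) (snd_code w) : nat) ->
  computable N ->
  computable (fun x => all (fun i => P i x) (iota 0 (N x)) : nat).
Proof.
move=> compP compN.
apply: (computable_ext
  (F := fun x => ~~ has (fun i => ~~ P i x) (iota 0 (N x)) : nat)).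
  move=> x; rewrite -all_predC; congr nat_of_bool.
  by apply: eq_all => i /=; rewrite negbK.
apply/computable_negb/(computable_has (P := fun i x => ~~ P i x)) => //.
exact: computable_negb.
Qed.

#[local] Hint Resolve computable_if computable_ifb computable_negb computable_andb
  computable_orb computable_leq computable_eq computable_has computable_all
  : computability.

(** * Course-of-values recursion *)

(** In a table of length [n], coded as nested pairs with the latest value
    outermost, the value with index [i] lies below [n - i.+1] others. *)
Definition entry (n T i : nat) : nat := fst_code (iter (n - i.+1) snd_code T).

Definition cov_table (G : nat -> nat -> (nat -> nat) -> nat) (p n : nat) : nat :=
  iteri n (fun i T => pair_code (G i p (entry i T)) T) 0.

(** [G n p rec] gives the value at [n] with parameter [p], and may call [rec] on
    smaller numbers.  Outside of that range [rec] returns meaningless values, so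
    it is never identified with [cov G] itself, but through [covP] only below
    [n]. *)
Definition cov (G : nat -> nat -> (nat -> nat) -> nat) (n p : nat) : nat :=
  G n p (entry n (cov_table G p n)).

Lemma entry_cov_table G p n i :
  i < n -> entry n (cov_table G p n) i = cov G i p.
Proof.
elim: n => // n IH; rewrite ltnS leq_eqVlt => /predU1P[->|lti].
  by rewrite /entry subnn /= fst_pair.
by rewrite -IH // /entry subSn // iterSr /= snd_pair.
Qed.

#[local] Arguments cov : simpl never.

(** Stated as a case analysis, so that unfolding one step of the recursion puts
    an abstract [rec] in the place of the table. *)
Variant cov_spec G n p : nat -> Prop :=
  CovSpec rec of (forall i, i < n -> rec i = cov G i p) : cov_spec G n p (G n p rec).

Lemma covP G n p : cov_spec G n p (cov G n p).
Proof. by constructor=> i; apply: entry_cov_table. Qed.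

Lemma computable_entry F G H : computable F -> computable G -> computable H ->
  computable (fun x => entry (F x) (G x) (H x)).
Proof.
move=> compF compG compH; apply: computable_fst.
apply: (computable_ext (F := fun x =>
  iteri (F x - (H x).+1) (fun _ z => snd_code z) (G x))).
  by move=> x; elim: (_ - _) => //= n ->.
by computability.
Qed.

#[local] Hint Resolve computable_entry : computability.

Lemma computable_cov G F P :
  computable (fun w => G (fst_code w) (fst_code (snd_code w))
                         (entry (fst_code w) (snd_code (snd_code w)))) ->
  computable F -> computable P -> computable (fun x => cov G (F x) (P x)).
Proof.
move=> compG compF compP.
have compGG A B C : computable A -> computable B -> computable C ->
    computable (fun x => G (A x) (B x) (entry (A x) (C x))).
  move=> compA compB compC.
  have := computable_comp1 (F := fun x => pair_code (A x) (pair_code (B x) (C x)))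
    compG; move=> /(_ ltac:(computability)); apply: computable_ext => x.
  by rewrite !(fst_pair, snd_pair).
apply: (compGG) => //; rewrite /cov_table; apply: computable_iteri => //.
  by computability.
apply: computable_pair; last by computability.
apply: (compGG); try by computability.
by apply: (computable_comp1 compP); computability.
Qed.

(** Course-of-values recursion for predicates, truth being the value 1. *)
Definition covb (G : nat -> nat -> (nat -> bool) -> bool) (n p : nat) : bool :=
  cov (fun n p rec => G n p (fun i => rec i == 1)) n p == 1.

#[local] Arguments covb : simpl never.

Variant covb_spec G n p : bool -> Prop :=
  CovbSpec rec of (forall i, i < n -> rec i = covb G i p) :
    covb_spec G n p (G n p rec).

Lemma covbP G n p : covb_spec G n p (covb G n p).
Proof.
rewrite /covb; case: covP => rec recE.
rewrite (_ : (_ == 1) = G n p (fun i => rec i == 1)); last by case: (G _ _ _).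
by constructor=> i /recE ->.
Qed.

Lemma computable_covb (G : nat -> nat -> (nat -> bool) -> bool) F P :
  computable (fun w => G (fst_code w) (fst_code (snd_code w))
    (fun i => entry (fst_code w) (snd_code (snd_code w)) i == 1) : nat) ->
  computable F -> computable P -> computable (fun x => covb G (F x) (P x) : nat).
Proof.
move=> compG compF compP; apply: computable_eq; last by computability.
exact: computable_cov.
Qed.

(** In the codes of strings, terms, formulas and environments, every node at which
    a recursion goes on has a nonzero tag.  This is why the recursive calls are
    made on smaller numbers. *)
Lemma ltn_tail t a : a < pair_code t.+1 a.
Proof. exact: ltn_pairr. Qed.

Lemma ltn_left t a b : a < pair_code t.+1 (pair_code a b).
Proof. exact: leq_ltn_trans (leq_pairl _ _) (ltn_tail _ _). Qed.

Lemma ltn_right t a b : b < pair_code t.+1 (pair_code a b).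
Proof. exact: leq_ltn_trans (leq_pairr _ _) (ltn_tail _ _). Qed.

#[local] Hint Resolve ltn_tail ltn_left ltn_right : core.

Definition projE := (fst_pair, snd_pair).

(** * Bit strings *)

(** Each bit is shifted by one, which keeps tag 0 for the empty string. *)
Fixpoint string_code (s : bitstring) : nat :=
  if s is b :: s' then pair_code b.+1 (string_code s') else 0.

Definition cat_code : nat -> nat -> nat :=
  cov (fun n p rec => if fst_code n == 0 then p
                      else pair_code (fst_code n) (rec (snd_code n))).

Lemma cat_codeE u v :
  cat_code (string_code u) (string_code v) = string_code (u ++ v).
Proof.
rewrite /cat_code; elim: u => [|b u IH] /=; first by [].
by case: covP => rec recE; rewrite !projE recE ?IH.
Qed.

Lemma computable_cat F G : computable F -> computable G ->
  computable (fun x => cat_code (F x) (G x)).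
Proof.
by move=> cF cG; rewrite /cat_code; apply: computable_cov => //; computability.
Qed.

Lemma string_code_inj : injective string_code.
Proof.
have neq0 b s : 0 = string_code (b :: s) -> False.
  by have := leq_pairl b.+1 (string_code s) => /= /[swap] <-.
elim=> [|b u IH] [|c v] //.
- by move/neq0.
- by move/esym/neq0.
- by move=> /= /pair_code_inj[[/(can_inj oddb)-> /IH ->]].
Qed.

(** The coding of strings is not onto, so a search over codes has to discard the
    numbers that code no string. *)
Definition is_string (n : nat) : bool :=
  covb (fun n _ rec => if fst_code n == 0 then n == 0
                       else (fst_code n <= 2) && rec (snd_code n)) n 0.

Lemma is_stringP n : reflect (exists s, string_code s = n) (is_string n).
Proof.
apply: (iffP idP); rewrite /is_string.
  have [k lekn] := ubnP n; elim: k n lekn => // k IH n; rewrite ltnS => lenk.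
  case: covbP => rec recE; case: eqP => [_ /eqP->|/eqP nz].
    by exists [::].
  case/andP=> le2; have lt : snd_code n < n by rewrite ltn_snd // lt0n.
  rewrite recE // => /IH[|s Es]; first exact: leq_trans lt lenk.
  exists ((fst_code n == 2) :: s); rewrite /= Es -{3}(pair_fst_snd n).
  by congr pair_code; case: (fst_code n) nz le2 => [|[|[]]].
case=> s <-; elim: s => [|b s IH] //=.
by case: covbP => rec recE; rewrite !projE recE ?IH // andbT; case: {recE} b.
Qed.

Lemma computable_is_string F :
  computable F -> computable (fun x => is_string (F x) : nat).
Proof.
by move=> cF; rewrite /is_string; apply: computable_covb => //; computability.
Qed.

#[local] Hint Resolve computable_cat computable_is_string : computability.

Lemma is_string_code s : is_string (string_code s).
Proof. by apply/is_stringP; exists s. Qed.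

Lemma leq_string_prefix u v : string_code u <= string_code (u ++ v).
Proof. by elim: u => //= b u IH; apply: leq_pair. Qed.

Lemma leq_string_suffix u v : string_code v <= string_code (u ++ v).
Proof.
by elim: u => //= b u IH; apply: leq_trans IH (ltnW (ltn_tail _ _)).
Qed.

(** Both relations are read off their definitions: the witnessing strings are
    parts of [v], so their codes are at most [v]. *)
Definition prefix_code (u v : nat) : bool :=
  has (fun x => is_string x && (cat_code u x == v)) (iota 0 v.+1).

Definition substring_code (u v : nat) : bool :=
  has (fun x => is_string x && has (fun y => is_string y &&
    (cat_code x (cat_code u y) == v)) (iota 0 v.+1)) (iota 0 v.+1).

Lemma prefix_codeP u v :
  reflect (is_prefix u v) (prefix_code (string_code u) (string_code v)).
Proof.
apply: (iffP hasP) => [[x' _ /andP[/is_stringP[x <-]]]|[x <-]].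
  by rewrite cat_codeE => /eqP/string_code_inj; exists x.
exists (string_code x).
  by rewrite mem_iota ltnS /= leq_string_suffix.
by rewrite is_string_code cat_codeE eqxx.
Qed.

Lemma substring_codeP u v :
  reflect (substring u v) (substring_code (string_code u) (string_code v)).
Proof.
apply: (iffP hasP) => [[x' _ /andP[/is_stringP[x <-] /hasP[y' _]]]|].
  case/andP=> /is_stringP[y <-]; rewrite !cat_codeE => /eqP/string_code_inj.
  by exists x, y.
case=> x [y <-]; exists (string_code x).
  by rewrite mem_iota ltnS /= leq_string_prefix.
rewrite is_string_code; apply/hasP; exists (string_code y).
  by rewrite mem_iota ltnS /= catA leq_string_suffix.
by rewrite is_string_code !cat_codeE eqxx.
Qed.


Lemma computable_prefix F G : computable F -> computable G ->
  computable (fun x => prefix_code (F x) (G x) : nat).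
Proof.
apply: (computable_uncurried (H := prefix_code)); rewrite /prefix_code.
by computability.
Qed.

Lemma computable_substring F G : computable F -> computable G ->
  computable (fun x => substring_code (F x) (G x) : nat).
Proof.
apply: (computable_uncurried (H := substring_code)); rewrite /substring_code.
by computability.
Qed.

(** * Terms *)

(** Accessors for the shape [pair_code tag (pair_code a b)] that the codes of
    most nodes share. *)
Definition arg1 (n : nat) : nat := fst_code (snd_code n).
Definition arg2 (n : nat) : nat := snd_code (snd_code n).

Lemma arg1_pair t a b : arg1 (pair_code t (pair_code a b)) = a.
Proof. by rewrite /arg1 !projE. Qed.

Lemma arg2_pair t a b : arg2 (pair_code t (pair_code a b)) = b.
Proof. by rewrite /arg2 !projE. Qed.

Definition argE := (arg1_pair, arg2_pair, projE).

Lemma pair_args n : pair_code (fst_code n) (pair_code (arg1 n) (arg2 n)) = n.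
Proof. by rewrite !pair_fst_snd. Qed.

Lemma ltn_arg1 n : 0 < fst_code n -> arg1 n < n.
Proof. by move=> /ltn_snd; apply: leq_ltn_trans; apply: leq_fst. Qed.

Lemma ltn_arg2 n : 0 < fst_code n -> arg2 n < n.
Proof. by move=> /ltn_snd; apply: leq_ltn_trans; apply: leq_snd. Qed.

Definition is_term (n : nat) : bool :=
  covb (fun n _ rec =>
    if fst_code n == 0 then true else
    if fst_code n <= 3 then snd_code n == 0 else
    [&& fst_code n == 4, rec (arg1 n) & rec (arg2 n)]) n 0.

Lemma is_termP n : reflect (exists t, term_code t = n) (is_term n).
Proof.
apply: (iffP idP); rewrite /is_term.
  have [j lenj] := ubnP n; elim: j n lenj => // j IH n; rewrite ltnS => lenj.
  case: covbP => rec recE; case: eqP => [tag0 _|/eqP tagN0].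
    by exists (Var (snd_code n)); rewrite /= -tag0 pair_fst_snd.
  case: leqP => [le3 /eqP snd0|lt3 /and3P[/eqP tag4]].
    have := pair_fst_snd n; rewrite snd0.
    case: (fst_code n) tagN0 le3 => [|[|[|[|]]]] // _ _ <-.
    - by exists E.
    - by exists Zero.
    - by exists One.
  have lt1 : arg1 n < n by rewrite ltn_arg1 ?tag4.
  have lt2 : arg2 n < n by rewrite ltn_arg2 ?tag4.
  rewrite !recE // => /IH[|s Es]; first exact: leq_trans lt1 lenj.
  case/IH=> [|t Et]; first exact: leq_trans lt2 lenj.
  by exists (Cat s t); rewrite /= Es Et -tag4 pair_args.
case=> t <-; elim: t => [x||||s IHs t IHt] /=; case: covbP => rec recE;
  by rewrite !argE // !recE // IHs.
Qed.

Lemma is_term_code t : is_term (term_code t).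
Proof. by apply/is_termP; exists t. Qed.

Lemma computable_is_term F :
  computable F -> computable (fun x => is_term (F x) : nat).
Proof.
move=> cF; rewrite /is_term /arg1 /arg2.
by apply: computable_covb => //; computability.
Qed.

Definition occurs_code : nat -> nat -> bool :=
  covb (fun n x rec =>
    if fst_code n == 0 then x == snd_code n else
    (fst_code n == 4) && (rec (arg1 n) || rec (arg2 n))).

Lemma occurs_codeE t x : occurs_code (term_code t) x = occurs x t.
Proof.
rewrite /occurs_code; elim: t => [y||||s IHs t IHt] /=; case: covbP => rec recE;
  by rewrite !argE // !recE // IHs IHt.
Qed.

Lemma computable_occurs F G : computable F -> computable G ->
  computable (fun x => occurs_code (F x) (G x) : nat).
Proof.
move=> cF cG; rewrite /occurs_code /arg1 /arg2.
by apply: computable_covb => //; computability.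
Qed.

(** A finite environment, the most recent binding first.  Variables without a
    binding denote the empty string, which makes [valuation] total. *)
Definition env : Type := seq (nat * bitstring).

Fixpoint valuation (e : env) : nat -> bitstring :=
  if e is (x, u) :: e' then update (valuation e') x u else fun=> [::].

Definition bind_code (x u e : nat) : nat :=
  pair_code 1 (pair_code (pair_code x u) e).

Fixpoint env_code (e : env) : nat :=
  if e is (x, u) :: e' then bind_code x (string_code u) (env_code e') else 0.

Definition lookup_code : nat -> nat -> nat :=
  cov (fun e x rec =>
    if fst_code e == 0 then 0 else
    if x == fst_code (arg1 e) then snd_code (arg1 e) else rec (arg2 e)).

Lemma lookup_codeE e x : lookup_code (env_code e) x = string_code (valuation e x).
Proof.
rewrite /lookup_code; elim: e => [|[y u] e IH] //=; case: covP => rec recE.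
rewrite /bind_code !argE /= recE; last exact: ltn_right.
by rewrite IH /update; case: eqP.
Qed.

Lemma computable_lookup F G : computable F -> computable G ->
  computable (fun x => lookup_code (F x) (G x)).
Proof.
move=> cF cG; rewrite /lookup_code /arg1 /arg2.
by apply: computable_cov => //; computability.
Qed.

#[local] Hint Resolve computable_prefix computable_substring computable_is_term
  computable_occurs computable_lookup : computability.

Definition eval_code : nat -> nat -> nat :=
  cov (fun n e rec =>
    if fst_code n == 0 then lookup_code e (snd_code n) else
    if fst_code n == 1 then string_code [::] else
    if fst_code n == 2 then string_code [:: false] else
    if fst_code n == 3 then string_code [:: true] else
    cat_code (rec (arg1 n)) (rec (arg2 n))).

(** The common form of the two structures: only the relation varies. *)
Definition string_structure (sub : bitstring -> bitstring -> Prop) : structure :=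
  @Structure bitstring [::] [:: false] [:: true] cat sub.

(** The relation of the structure has no influence on the value of a term, so one
    evaluator serves all of them. *)
Lemma eval_codeE sub e t :
  eval_code (term_code t) (env_code e) =
  string_code (teval (A := string_structure sub) (valuation e) t).
Proof.
rewrite /eval_code; elim: t => [x||||s IHs t IHt] /=; case: covP => rec recE;
  rewrite !argE //=; first exact: lookup_codeE.
by rewrite !recE // IHs IHt cat_codeE.
Qed.

Lemma computable_eval F G : computable F -> computable G ->
  computable (fun x => eval_code (F x) (G x)).
Proof.
move=> cF cG; rewrite /eval_code /arg1 /arg2.
by apply: computable_cov => //; computability.
Qed.

#[local] Hint Resolve computable_eval : computability.

(** * Syntax of formulas *)

Definition is_atom (n : nat) : bool :=
  [&& fst_code n <= 1, is_term (arg1 n) & is_term (arg2 n)].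

Lemma is_atomP n :
  reflect (exists s t, n = formula_code (Eq s t) \/ n = formula_code (Sub s t))
          (is_atom n).
Proof.
apply: (iffP and3P) => [[]|[s [t [] ->]]] /=; last 2 first.
- by rewrite !argE !is_term_code.
- by rewrite !argE !is_term_code.
move=> tag /is_termP[s Es] /is_termP[t Et]; have := pair_args n.
by case: (fst_code n) tag => [|[|]] // _ <-; rewrite -Es -Et;
  exists s, t; [left | right].
Qed.

(** The result of the recogniser on a Sigma formula with these counts.  Tag 1
    tells it from 0, the answer on every other number, and [sigma_add] carries the
    answer 0 on from either side. *)
Definition sigma_value (m k : nat) : nat := pair_code 1 (pair_code m k).

Definition sigma_add (u v : nat) : nat :=
  if (fst_code u == 1) && (fst_code v == 1)
  then sigma_value (arg1 u + arg1 v) (arg2 u + arg2 v) else 0.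

Lemma sigma_addE m k m' k' :
  sigma_add (sigma_value m k) (sigma_value m' k') = sigma_value (m + m') (k + k').
Proof. by rewrite /sigma_add !argE. Qed.

Lemma sigma_value_inj m k m' k' :
  sigma_value m k = sigma_value m' k' -> m = m' /\ k = k'.
Proof. by move=> /pair_code_inj[_] /pair_code_inj. Qed.

Lemma sigma_value_neq0 m k : sigma_value m k <> 0.
Proof.
by have := leq_pairl 1 (pair_code m k) => /[swap]; rewrite /sigma_value => ->.
Qed.

Lemma sigma_add_inv u v m k : sigma_add u v = sigma_value m k ->
  exists m1 k1 m2 k2, [/\ u = sigma_value m1 k1, v = sigma_value m2 k2,
                          m = m1 + m2 & k = k1 + k2].
Proof.
rewrite /sigma_add; case: andP => [[/eqP u1 /eqP v1]|_ /esym/sigma_value_neq0 //].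
move=> /sigma_value_inj[<- <-].
exists (arg1 u), (arg2 u), (arg1 v), (arg2 v); split=> //.
- by rewrite -{1}(pair_args u) u1.
- by rewrite -{1}(pair_args v) v1.
Qed.

(** In the code of a bounded quantifier, the second argument is the body
    [Sub (Var x) t] joined to the matrix by [And] or [Imp]; these are the term [t]
    and the matrix. *)
Definition bound_term (n : nat) : nat := arg2 (arg1 (arg2 n)).
Definition matrix (n : nat) : nat := arg2 (arg2 n).

(** Here [c] is the tag of the connective in the body, 3 for [And] under [Ex] and 5
    for [Imp] under [All]. *)
Definition is_bounded (c n : nat) : bool :=
  [&& fst_code (arg2 n) == c, fst_code (arg1 (arg2 n)) == 1,
      arg1 (arg1 (arg2 n)) == pair_code 0 (arg1 n), is_term (bound_term n)
    & ~~ occurs_code (bound_term n) (arg1 n)].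

Lemma is_boundedP c n : is_bounded c n ->
  exists2 t, ~~ occurs (arg1 n) t
  & n = pair_code (fst_code n) (pair_code (arg1 n)
          (pair_code c (pair_code (formula_code (Sub (Var (arg1 n)) t)) (matrix n)))).
Proof.
case/and5P=> /eqP <- /eqP tag1 /eqP var /is_termP[t Et].
rewrite -Et occurs_codeE => notocc; exists t => //=.
by rewrite Et -var -tag1 !pair_args.
Qed.

(** The recursion skips the body of a bounded quantifier and goes on with its
    matrix: the body of a bounded universal quantifier is an implication, which is
    not a Sigma formula.  A quantifier without a bound gets the answer 0, as it
    should when unbounded quantifiers are excluded. *)
Definition sigma_code (n : nat) : nat :=
  cov (fun n _ rec =>
    if is_atom n || (fst_code n == 2) && is_atom (snd_code n)
    then sigma_value 0 0 else
    if (fst_code n == 3) || (fst_code n == 4)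
    then sigma_add (rec (arg1 n)) (rec (arg2 n)) else
    if (fst_code n == 6) && is_bounded 3 n
    then sigma_add (sigma_value 1 0) (rec (matrix n)) else
    if (fst_code n == 7) && is_bounded 5 n
    then sigma_add (sigma_value 0 1) (rec (matrix n)) else 0) n 0.

Lemma computable_sigma F :
  computable F -> computable (fun x => sigma_code (F x)).
Proof.
move=> cF; rewrite /sigma_code /is_bounded /sigma_add /sigma_value /is_atom
  /bound_term /matrix /arg1 /arg2.
by apply: computable_cov => //; computability.
Qed.

Lemma ltn_matrix n : 0 < fst_code n -> matrix n < n.
Proof.
move=> /ltn_arg2; apply: leq_ltn_trans.
exact: leq_trans (leq_snd _) (leq_snd _).
Qed.

Lemma sigma_code_sound n m k : sigma_code n = sigma_value m k ->
  exists2 f, Sigma 0 m k f & formula_code f = n.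
Proof.
rewrite /sigma_code.
have [j lenj] := ubnP n; elim: j n lenj m k => // j IH n.
rewrite ltnS => lenj m k; case: covP => rec recE.
have IHrec i m' k' : i < n -> rec i = sigma_value m' k' ->
    exists2 f, Sigma 0 m' k' f & formula_code f = i.
  by move=> ltin; rewrite recE //; apply: IH; apply: leq_trans ltin lenj.
case: ifP => [atom /sigma_value_inj[<- <-]|_].
  case/orP: atom => [/is_atomP[s [t [] ->]]|/andP[/eqP tag2]].
  - by exists (Eq s t) => //; constructor.
  - by exists (Sub s t) => //; constructor.
  case/is_atomP=> s [t [] snd]; rewrite -(pair_fst_snd n) tag2 snd.
  - by exists (Not (Eq s t)) => //; constructor.
  - by exists (Not (Sub s t)) => //; constructor.
case: ifP => [tag34 /sigma_add_inv[m1 [k1 [m2 [k2 [E1 E2 -> ->]]]]]|_].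
  have tag_gt0 : 0 < fst_code n by case/orP: tag34 => /eqP ->.
  have [f Sf Ef] := IHrec _ _ _ (ltn_arg1 tag_gt0) E1.
  have [g Sg Eg] := IHrec _ _ _ (ltn_arg2 tag_gt0) E2.
  rewrite -(pair_args n) -Ef -Eg; case/orP: tag34 => /eqP ->.
  - by exists (And f g) => //; apply: (Sigma_And Sf Sg).
  - by exists (Or f g) => //; apply: (Sigma_Or Sf Sg).
case: ifP => [/andP[/eqP tag6 /is_boundedP[t notocc En]]|_].
  case/sigma_add_inv=> m1 [k1 [m2 [k2 [/sigma_value_inj[<- <-] E2 -> ->]]]].
  have lt : matrix n < n by rewrite ltn_matrix ?tag6.
  have [f Sf Ef] := IHrec _ _ _ lt E2.
  exists (BEx (arg1 n) t f); first exact: Sigma_BEx.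
  by rewrite [RHS]En tag6 -Ef.
case: ifP => [/andP[/eqP tag7 /is_boundedP[t notocc En]]|_].
  case/sigma_add_inv=> m1 [k1 [m2 [k2 [/sigma_value_inj[<- <-] E2 -> ->]]]].
  have lt : matrix n < n by rewrite ltn_matrix ?tag7.
  have [f Sf Ef] := IHrec _ _ _ lt E2.
  exists (BAll (arg1 n) t f); first exact: Sigma_BAll.
  by rewrite [RHS]En tag7 -Ef.
by move/esym/sigma_value_neq0.
Qed.

Lemma sigma_code_complete m k f :
  Sigma 0 m k f -> sigma_code (formula_code f) = sigma_value m k.
Proof.
suff H n : Sigma n m k f -> n = 0 -> sigma_code (formula_code f) = sigma_value m k.
  by move=> /H; apply.
rewrite /sigma_code.
elim=> {n m k f} [s t|s t|s t|s t
  |n m k n' m' k' a b _ IHa _ IHb|n m k n' m' k' a b _ IHa _ IHb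
  |n m k x t a notocc _ IH|n m k x t a notocc _ IH|n m k x a _ _] //= En;
  case: covP => rec recE; rewrite /is_atom !argE //= ?is_term_code //.
- have [En1 En2] : n = 0 /\ n' = 0 by lia.
  by rewrite !recE // IHa // IHb // sigma_addE.
- have [En1 En2] : n = 0 /\ n' = 0 by lia.
  by rewrite !recE // IHa // IHb // sigma_addE.
- rewrite /is_bounded /bound_term /matrix !argE /= eqxx is_term_code occurs_codeE.
  rewrite notocc recE ?IH ?sigma_addE //.
  exact: ltn_trans (ltn_right _ _ _) (ltn_right _ _ _).
- rewrite /is_bounded /bound_term /matrix !argE /= eqxx is_term_code occurs_codeE.
  rewrite notocc recE ?IH ?sigma_addE //.
  exact: ltn_trans (ltn_right _ _ _) (ltn_right _ _ _).
Qed.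

Definition free_code : nat -> nat -> bool :=
  covb (fun n x rec =>
    if fst_code n <= 1 then occurs_code (arg1 n) x || occurs_code (arg2 n) x else
    if fst_code n == 2 then rec (snd_code n) else
    if fst_code n <= 5 then rec (arg1 n) || rec (arg2 n) else
    (x != arg1 n) && rec (arg2 n)).

Lemma free_codeE f x : free_code (formula_code f) x = free x f.
Proof.
rewrite /free_code.
elim: f => [s t|s t|a IHa|a IHa b IHb|a IHa b IHb|a IHa b IHb|y a IHa|y a IHa] /=;
  case: covbP => rec recE; rewrite !argE /= ?occurs_codeE ?recE //;
  by rewrite ?IHa ?IHb.
Qed.

Lemma computable_free F G : computable F -> computable G ->
  computable (fun x => free_code (F x) (G x) : nat).
Proof.
move=> cF cG; rewrite /free_code /arg1 /arg2.
by apply: computable_covb => //; computability.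
Qed.

#[local] Hint Resolve computable_sigma computable_free : computability.

Lemma occurs_leq x t : occurs x t -> x <= term_code t.
Proof.
elim: t => //= [y /eqP ->|s IHs t IHt]; first exact: leq_pairr.
case/orP=> [/IHs|/IHt] /leq_trans; apply; exact: ltnW.
Qed.

Lemma free_leq x f : free x f -> x <= formula_code f.
Proof.
elim: f => [s t|s t|a IHa|a IHa b IHb|a IHa b IHb|a IHa b IHb|y a IHa|y a IHa] /=.
- case/orP=> /occurs_leq /leq_trans; apply; apply: leq_trans (leq_pairr _ _);
  [exact: leq_pairl | exact: leq_pairr].
- by case/orP=> /occurs_leq /leq_trans; apply; apply: ltnW.
- by move=> /IHa /leq_trans; apply; apply: ltnW.
- by case/orP=> [/IHa|/IHb] /leq_trans; apply; apply: ltnW.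
- by case/orP=> [/IHa|/IHb] /leq_trans; apply; apply: ltnW.
- by case/orP=> [/IHa|/IHb] /leq_trans; apply; apply: ltnW.
- by case/andP=> _ /IHa /leq_trans; apply; apply: ltnW.
- by case/andP=> _ /IHa /leq_trans; apply; apply: ltnW.
Qed.

(** A variable that is free in a formula is at most its code ([free_leq]). *)
Definition closed_code (n : nat) : bool :=
  all (fun x => ~~ free_code n x) (iota 0 n.+1).

Lemma closed_codeP f : reflect (sentence f) (closed_code (formula_code f)).
Proof.
apply: (iffP allP) => [closed x|closed x _]; last by rewrite free_codeE.
apply/negP=> freex; have := closed x; rewrite free_codeE freex.
by rewrite mem_iota /= ltnS free_leq // => /(_ isT).
Qed.

Lemma computable_closed F :
  computable F -> computable (fun x => closed_code (F x) : nat).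
Proof.
move=> cF; rewrite /closed_code; apply: (computable_comp1 (H := fun n =>
  all (fun x => ~~ free_code n x) (iota 0 n.+1) : nat)) cF.
by computability.
Qed.

#[local] Hint Resolve computable_closed : computability.

(** * Truth *)

Lemma teval_eq (A : structure) (v w : nat -> A) t :
  (forall x, occurs x t -> v x = w x) -> teval v t = teval w t.
Proof.
elim: t => //= [x|s IHs t IHt] eqvw; first by apply: eqvw; apply: eqxx.
by rewrite IHs ?IHt // => x occ; apply: eqvw; rewrite occ ?orbT.
Qed.

(** Coincidence lemma: the truth of a formula depends on its free variables only.
    For sentences it reduces truth to a single valuation. *)
Lemma sat_eq (A : structure) f (v w : nat -> A) :
  (forall x, free x f -> v x = w x) -> sat v f <-> sat w f.
Proof.
elim: f v w => [s t|s t|a IHa|a IHa b IHb|a IHa b IHb|a IHa b IHb|y a IHa|y a IHa]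
  /= v w eqvw.
- by rewrite !(@teval_eq _ v w) // => x occ; apply: eqvw; rewrite occ ?orbT.
- by rewrite !(@teval_eq _ v w) // => x occ; apply: eqvw; rewrite occ ?orbT.
- by have := IHa v w eqvw; tauto.
- have Ha : sat v a <-> sat w a by apply: IHa => x fx; apply: eqvw; rewrite fx.
  have Hb : sat v b <-> sat w b by apply: IHb => x fx; apply: eqvw; rewrite fx orbT.
  by tauto.
- have Ha : sat v a <-> sat w a by apply: IHa => x fx; apply: eqvw; rewrite fx.
  have Hb : sat v b <-> sat w b by apply: IHb => x fx; apply: eqvw; rewrite fx orbT.
  by tauto.
- have Ha : sat v a <-> sat w a by apply: IHa => x fx; apply: eqvw; rewrite fx.
  have Hb : sat v b <-> sat w b by apply: IHb => x fx; apply: eqvw; rewrite fx orbT.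
  by tauto.
- have Ha u : sat (update v y u) a <-> sat (update w y u) a.
    apply: IHa => x fx; rewrite /update; case: eqP => // /eqP neq.
    by apply: eqvw; rewrite neq.
  by split=> -[u /Ha]; exists u.
- have Ha u : sat (update v y u) a <-> sat (update w y u) a.
    apply: IHa => x fx; rewrite /update; case: eqP => // /eqP neq.
    by apply: eqvw; rewrite neq.
  by split=> + u => /(_ u) /Ha.
Qed.

Definition search (subc : nat -> nat -> bool) (p : pred nat) (n : nat) : bool :=
  has (fun u => [&& is_string u, subc u n & p u]) (iota 0 n.+1).

#[local] Arguments search : simpl never.

Lemma searchP (sub : bitstring -> bitstring -> Prop) subc (p : pred nat) v :
  (forall u v, reflect (sub u v) (subc (string_code u) (string_code v))) ->
  (forall u v, sub u v -> string_code u <= string_code v) ->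
  reflect (exists2 u, sub u v & p (string_code u)) (search subc p (string_code v)).
Proof.
move=> subP sub_leq; apply: (iffP hasP).
  by case=> u' _ /and3P[/is_stringP[u <-] /subP subuv pu]; exists u.
case=> u subuv pu; exists (string_code u).
  by rewrite mem_iota /= ltnS sub_leq.
by rewrite is_string_code pu andbT; apply/subP.
Qed.

(** One level of the evaluator.  Connectives are handled by recursion in the
    environment [e]; a quantifier hands its matrix over to [next], in an extended
    environment.  On the code of a Sigma formula only the tags 6 and 7 reach the
    last two branches.  A universal quantifier is treated as the negation of a search for a counterexample. *)
Definition sat_step (subc next : nat -> nat -> bool) :=
  covb (fun n e rec =>
    if fst_code n == 0 then eval_code (arg1 n) e == eval_code (arg2 n) e else
    if fst_code n == 1 then subc (eval_code (arg1 n) e) (eval_code (arg2 n) e) else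
    if fst_code n == 2 then ~~ rec (snd_code n) else
    if fst_code n == 3 then rec (arg1 n) && rec (arg2 n) else
    if fst_code n == 4 then rec (arg1 n) || rec (arg2 n) else
    let bound := eval_code (bound_term n) e in
    if fst_code n == 6
    then search subc (fun u => next (matrix n) (bind_code (arg1 n) u e)) bound
    else ~~ search subc (fun u => ~~ next (matrix n) (bind_code (arg1 n) u e)) bound).

(** Level 0 meets no quantifier, hence the arbitrary [next]. *)
Fixpoint sat_code (subc : nat -> nat -> bool) (q : nat) : nat -> nat -> bool :=
  sat_step subc (if q is q'.+1 then sat_code subc q' else fun _ _ => false).

Definition computable_rel (r : nat -> nat -> bool) : Prop :=
  forall F G, computable F -> computable G ->
    computable (fun x => r (F x) (G x) : nat).

Lemma computable_sat_step subc next :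
  computable_rel subc -> computable_rel next -> computable_rel (sat_step subc next).
Proof.
rewrite /computable_rel => comp_sub comp_next F G cF cG.
rewrite /sat_step /search /bind_code /bound_term /matrix /arg1 /arg2.
by apply: computable_covb => //; cbv zeta; computability.
Qed.

Lemma computable_sat subc q :
  computable_rel subc -> computable_rel (sat_code subc q).
Proof.
move=> comp_sub; elim: q => [|q IHq]; apply: computable_sat_step => // F G _ _.
exact: (computable_const 0).
Qed.

(** A level whose [next] is right for fewer than [q] quantifiers is right for at
    most [q] of them.  The bound on codes is what makes the search for a witness
    exhaustive, and the matrix is evaluated with the quantified variable bound to
    the candidate, which leaves the value of the bounding term unchanged as the
    variable does not occur in it. *)
Lemma sat_stepP (sub : bitstring -> bitstring -> Prop)
    (subc next : nat -> nat -> bool) q :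
  (forall u v, reflect (sub u v) (subc (string_code u) (string_code v))) ->
  (forall u v, sub u v -> string_code u <= string_code v) ->
  (forall m k f e, m + k < q -> Sigma 0 m k f ->
     next (formula_code f) (env_code e) <->
     sat (A := string_structure sub) (valuation e) f) ->
  forall m k f e, m + k <= q -> Sigma 0 m k f ->
    sat_step subc next (formula_code f) (env_code e) <->
    sat (A := string_structure sub) (valuation e) f.
Proof.
move=> subP sub_leq nextP m k f e.
have eqE s t : sat_step subc next (formula_code (Eq s t)) (env_code e) <->
    sat (A := string_structure sub) (valuation e) (Eq s t).
  rewrite /sat_step; case: covbP => rec _.
  rewrite [formula_code _]/= !argE /= !(eval_codeE sub).
  by rewrite (inj_eq string_code_inj); split=> /eqP.
have subE s t : sat_step subc next (formula_code (Sub s t)) (env_code e) <->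
    sat (A := string_structure sub) (valuation e) (Sub s t).
  rewrite /sat_step; case: covbP => rec _.
  rewrite [formula_code _]/= !argE /= !(eval_codeE sub).
  by split=> /subP.
suff H n : Sigma n m k f -> n = 0 -> m + k <= q ->
    sat_step subc next (formula_code f) (env_code e) <->
    sat (A := string_structure sub) (valuation e) f.
  by move=> lemk /H; apply.
elim=> {n m k f} [s t|s t|s t|s t
  |n m k n' m' k' a b _ IHa _ IHb|n m k n' m' k' a b _ IHa _ IHb
  |n m k x t a notocc Sa _|n m k x t a notocc Sa _|n m k x a _ _] // En lemk.
- have := eqE s t; rewrite {2}/sat_step [formula_code (Not _)]/=.
  case: covbP => rec recE.
  by rewrite !argE /= recE // => <-; split=> /negP.
- have := subE s t; rewrite {2}/sat_step [formula_code (Not _)]/=.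
  case: covbP => rec recE.
  by rewrite !argE /= recE // => <-; split=> /negP.
- have Ha := IHa (ltac:(lia)) (ltac:(lia)).
  have Hb := IHb (ltac:(lia)) (ltac:(lia)).
  suff -> : sat_step subc next (formula_code (Or a b)) (env_code e) =
      sat_step subc next (formula_code a) (env_code e)
      || sat_step subc next (formula_code b) (env_code e).
    by split=> [/orP[/Ha|/Hb]|[/Ha ->|/Hb ->]]; rewrite ?orbT; [left | right | |].
  rewrite {1}/sat_step [formula_code (Or _ _)]/=.
  by case: covbP => rec recE; rewrite !argE /= !recE.
- have Ha := IHa (ltac:(lia)) (ltac:(lia)).
  have Hb := IHb (ltac:(lia)) (ltac:(lia)).
  suff -> : sat_step subc next (formula_code (And a b)) (env_code e) =
      sat_step subc next (formula_code a) (env_code e)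
      && sat_step subc next (formula_code b) (env_code e).
    by split=> [/andP[/Ha sa /Hb sb]|[/Ha -> /Hb ->]].
  rewrite {1}/sat_step [formula_code (And _ _)]/=.
  by case: covbP => rec recE; rewrite !argE /= !recE.
- have nextE u : next (formula_code a) (bind_code x (string_code u) (env_code e)) <->
      sat (A := string_structure sub) (update (valuation e) x u) a.
    by subst n; apply: (nextP m k a ((x, u) :: e)) Sa; lia.
  have tE (u : bitstring) :
      teval (A := string_structure sub) (update (valuation e) x u) t =
      teval (A := string_structure sub) (valuation e) t.
    apply: teval_eq => y occ; rewrite /update; case: eqP => // eqyx.
    by rewrite -eqyx occ in notocc.
  rewrite /sat_step [formula_code _]/=; case: covbP => rec _.
  rewrite !argE /= /bound_term /matrix !argE (eval_codeE sub).
  split=> [/(searchP _ _ subP sub_leq)[u subu /nextE satu]|[u]].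
    by exists u; rewrite tE {1}/update eqxx.
  rewrite tE {1}/update eqxx => -[subu /nextE satu].
  by apply/(searchP _ _ subP sub_leq); exists u.
- have nextE u : next (formula_code a) (bind_code x (string_code u) (env_code e)) <->
      sat (A := string_structure sub) (update (valuation e) x u) a.
    by subst n; apply: (nextP m k a ((x, u) :: e)) Sa; lia.
  have tE (u : bitstring) :
      teval (A := string_structure sub) (update (valuation e) x u) t =
      teval (A := string_structure sub) (valuation e) t.
    apply: teval_eq => y occ; rewrite /update; case: eqP => // eqyx.
    by rewrite -eqyx occ in notocc.
  rewrite /sat_step [formula_code _]/=; case: covbP => rec _.
  rewrite !argE /= /bound_term /matrix !argE (eval_codeE sub).
  split=> [/negP none u|all_sat].
    rewrite tE {1}/update eqxx => subu; apply/nextE/negPn/negP => unsat.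
    by apply: none; apply/(searchP _ _ subP sub_leq); exists u.
  apply/negP => /(searchP _ _ subP sub_leq)[u subu /negP[]].
  by apply/nextE/all_sat; rewrite tE {1}/update eqxx.
Qed.

Lemma sat_codeP (sub : bitstring -> bitstring -> Prop)
    (subc : nat -> nat -> bool) q m k f e :
  (forall u v, reflect (sub u v) (subc (string_code u) (string_code v))) ->
  (forall u v, sub u v -> string_code u <= string_code v) ->
  m + k <= q -> Sigma 0 m k f ->
  sat_code subc q (formula_code f) (env_code e) <->
  sat (A := string_structure sub) (valuation e) f.
Proof.
move=> subP sub_leq; elim: q m k f e => [|q IHq] m k f e;
  by apply: sat_stepP => // m' k' f' e' lt; apply: IHq.
Qed.

(** The decision procedure recognises the Sigma formulas with the right counts,
    checks that they are closed, and evaluates them at level [m + k] in the empty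
    environment. *)
Lemma decidable_fragment (sub : bitstring -> bitstring -> Prop)
    (subc : nat -> nat -> bool) m k :
  (forall u v, reflect (sub u v) (subc (string_code u) (string_code v))) ->
  (forall u v, sub u v -> string_code u <= string_code v) ->
  computable_rel subc ->
  decidable_set (fragment 0 m k (string_structure sub)).
Proof.
move=> subP sub_leq comp_sub.
pose decide n := [&& sigma_code n == sigma_value m k, closed_code n
                   & sat_code subc (m + k) n (env_code [::])].
have [f Hf] : computable (fun n => decide n : nat).
  have comp_sat := @computable_sat subc (m + k) comp_sub.
  rewrite /decide /computable_rel in comp_sat *.
  by computability.
have decideP n : reflect
    (exists2 g, fragment 0 m k (string_structure sub) g & formula_code g = n)
    (decide n).
  apply: (iffP and3P) => [[/eqP Sn closed satn]|[g [Sg closed trueg] <-]].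
    have [g Sg Eg] := sigma_code_sound Sn; exists g => //.
    rewrite -Eg in closed satn; move/closed_codeP: closed => closed.
    split=> // v; have /sat_eq[_] : forall x, free x g -> v x = valuation [::] x.
      by move=> x; rewrite (negbTE (closed x)).
    by apply; apply/(sat_codeP [::] subP sub_leq (leqnn _) Sg).
  split; first by rewrite (sigma_code_complete Sg).
    exact/closed_codeP.
  by apply/(sat_codeP [::] subP sub_leq (leqnn _) Sg).
exists f => n; have := Hf n.
by case: decideP => [inS|notinS]; split=> // /notinS.
Qed.

Theorem corollary5 : forall m k : nat,
  decidable_set (fragment 0 m k strB) /\ decidable_set (fragment 0 m k strD).
Proof.
move=> m k; split.
- apply: (decidable_fragment m k substring_codeP _ computable_substring).
  move=> u _ [x [y <-]]; apply: leq_trans (leq_string_suffix _ _).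
  exact: leq_string_prefix.
- apply: (decidable_fragment m k prefix_codeP _ computable_prefix).
  by move=> u _ [x <-]; apply: leq_string_prefix.
Qed.
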